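(* Let $\mathsf{C}$ be a strict braided monoidal category and let $\mathbb{H}=(H_1,H_2)$ be an $\mathtt{s}$-Hopf brace in $\mathsf{C}$. Then $(H_1,\Gamma_{H_1},\lambda_H^2)$ is a brace triple in $\mathsf{C}$, where $\Gamma_{H_1}=\mu_H^1\circ(\lambda_H^1\otimes\mu_H^2)\circ(\delta_H\otimes H)$.
   Context: $\mathsf{C}$ is a strict braided monoidal category with tensor product $\otimes$, unit object $K$ and braiding $c$ (not assumed symmetric). For an object $P$ and a morphism $f$, $P\otimes f$ means $id_P\otimes f$ and $f\otimes P$ means $f\otimes id_P$. Algebras, coalgebras, bialgebras and Hopf algebras are internal to $\mathsf{C}$; the tensor product of coalgebras $D,E$ has coproduct $(D\otimes c_{D,E}\otimes E)\circ(\delta_D\otimes\delta_E)$ and counit $\varepsilon_D\otimes\varepsilon_E$, and the tensor product of algebras $A,B$ has product $(\mu_A\otimes\mu_B)\circ(A\otimes c_{B,A}\otimes B)$. A Hopf algebra $H=(H,\eta_H,\mu_H,\varepsilon_H,\delta_H,\lambda_H)$ is a bialgebra with a morphism (antipode) $\lambda_H$ such that $\mu_H\circ(H\otimes\lambda_H)\circ\delta_H=\eta_H\circ\varepsilon_H=\mu_H\circ(\lambda_H\otimes H)\circ\delta_H$. Hopf brace: a coalgebra $(H,\varepsilon_H,\delta_H)$ with two Hopf algebra structures $H_1=(H,\eta_H^1,\mu_H^1,\varepsilon_H,\delta_H,\lambda_H^1)$ and $H_2=(H,\eta_H^2,\mu_H^2,\varepsilon_H,\delta_H,\lambda_H^2)$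 in $\mathsf{C}$ such that $\mu_H^2\circ(H\otimes\mu_H^1)=\mu_H^1\circ(\mu_H^2\otimes\Gamma_{H_1})\circ(H\otimes c_{H,H}\otimes H)\circ(\delta_H\otimes H\otimes H)$, where $\Gamma_{H_1}=\mu_H^1\circ(\lambda_H^1\otimes\mu_H^2)\circ(\delta_H\otimes H)$. It is denoted $\mathbb{H}=(H_1,H_2)$. $\mathtt{s}$-Hopf brace: a Hopf brace $\mathbb{H}=(H_1,H_2)$ such that (i) $(\Gamma_{H_1}\otimes H)\circ(H\otimes c_{H,H})\circ(\delta_H\otimes H)=(\Gamma_{H_1}\otimes H)\circ(H\otimes c_{H,H})\circ((c_{H,H}\circ\delta_H)\otimes H)$; (ii) $\lambda_H^1$ and $\lambda_H^2$ are isomorphisms in $\mathsf{C}$, and (ii.1) $\mu_H^1\circ(H\otimes\Gamma_{H_1})\circ((\delta_H\circ\lambda_H^2)\otimes H)=\mu_H^1\circ(H\otimes\Gamma_{H_1})\circ(((\lambda_H^2\otimes\lambda_H^2)\circ\delta_H)\otimes H)$, (ii.2) $\Gamma_{H_1}\circ(\lambda_H^2\otimes H)\circ\delta_H=(\lambda_H^1)^{-1}\circ\lambda_H^2$. Brace triple: $(H,\gamma_H,T_H)$ with $H=(H,\eta_H,\mu_H,\varepsilon_H,\delta_H,\lambda_H)$ a Hopf algebra in $\mathsf{C}$ with $\lambda_H$ an isomorphism, and morphisms $\gamma_H:H\otimes H\to H$, $T_H:H\to H$ such that (i) $(\gamma_H\otimes H)\circ(H\otimes c_{H,H})\circ(\delta_H\otimes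 H)=(\gamma_H\otimes H)\circ(H\otimes c_{H,H})\circ((c_{H,H}\circ\delta_H)\otimes H)$; (ii) $\gamma_H$ is a coalgebra morphism; (iii) $\gamma_H\circ(H\otimes\mu_H)=\mu_H\circ(\gamma_H\otimes\gamma_H)\circ(H\otimes c_{H,H}\otimes H)\circ(\delta_H\otimes H\otimes H)$; (iv) $\gamma_H\circ(H\otimes\gamma_H)=\gamma_H\circ((\mu_H\circ(H\otimes\gamma_H)\circ(\delta_H\otimes H))\otimes H)$; (v) $\gamma_H\circ(\eta_H\otimes H)=id_H$; (vi) $T_H$ is an isomorphism with (vi.1) $\delta_H\circ T_H=c_{H,H}\circ(T_H\otimes T_H)\circ\delta_H$, (vi.2) $\varepsilon_H\circ T_H=\varepsilon_H$, (vi.3) $\mu_H\circ(H\otimes\gamma_H)\circ((\delta_H\circ T_H)\otimes H)=\mu_H\circ(H\otimes\gamma_H)\circ(((T_H\otimes T_H)\circ\delta_H)\otimes H)$, (vi.4) $\gamma_H\circ(H\otimes T_H)\circ\delta_H=\lambda_H$, (vi.5) $\gamma_H\circ(T_H\otimes H)\circ\delta_H=\lambda_H^{-1}\circ T_H$. *)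

(* Defs.v *)
Set Implicit Arguments.
Unset Strict Implicit.
Unset Printing Implicit Defensive.

Declare Scope cat_scope.
Delimit Scope cat_scope with cat.
Local Open Scope cat_scope.

(** Categories are presented with one collection of morphisms and functions
    [dom], [cod], so that the strictness axioms [(f ⊗ g) ⊗ h = f ⊗ (g ⊗ h)] and
    [K ⊗ f = f = f ⊗ K] are plain equations, without transport along equalities
    of objects.  [comp g f] is meant to be "g after f"; it is a total function,
    but the axioms constrain it only when [dom g = cod f], and its value on other
    pairs is irrelevant.  An equation between morphisms includes the equality
    of their domains and codomains. *)
Record category := Category {
  obj : Type;
  mor : Type;
  dom : mor -> obj;
  cod : mor -> obj;
  idm : obj -> mor;
  comp : mor -> mor -> mor;
  dom_id : forall A, dom (idm A) = A;
  cod_id : forall A, cod (idm A) = A;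
  dom_comp : forall g f, dom g = cod f -> dom (comp g f) = dom f;
  cod_comp : forall g f, dom g = cod f -> cod (comp g f) = cod g;
  comp_id_l : forall f, comp (idm (cod f)) f = f;
  comp_id_r : forall f, comp f (idm (dom f)) = f;
  comp_assoc : forall h g f, dom h = cod g -> dom g = cod f ->
    comp h (comp g f) = comp (comp h g) f
}.

Arguments dom {c} _.
Arguments cod {c} _.
Arguments idm {c} _.
Arguments comp {c} _ _.

(** As in [P ⊗ f] for [id_P ⊗ f], an object may stand for its identity. *)
Coercion idm : obj >-> mor.

Bind Scope cat_scope with mor.

Notation "g ∘ f" := (comp g f) (at level 50, left associativity) : cat_scope.

Definition hom (C : category) (f : mor C) (A B : obj C) : Prop :=
  dom f = A /\ cod f = B.

Definition is_inverse (C : category) (f g : mor C) : Prop :=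
  hom g (cod f) (dom f) /\ g ∘ f = idm (dom f) /\ f ∘ g = idm (cod f).

Definition is_iso (C : category) (f : mor C) : Prop :=
  exists g, is_inverse f g.

Record strict_monoidal_category := StrictMonoidalCategory {
  smc_cat :> category;
  tenso : obj smc_cat -> obj smc_cat -> obj smc_cat;
  tens : mor smc_cat -> mor smc_cat -> mor smc_cat;
  unit_obj : obj smc_cat;
  dom_tens : forall f g, dom (tens f g) = tenso (dom f) (dom g);
  cod_tens : forall f g, cod (tens f g) = tenso (cod f) (cod g);
  tens_id : forall A B, tens (idm A) (idm B) = idm (tenso A B);
  tens_comp : forall f' f g' g, dom f' = cod f -> dom g' = cod g ->
    tens (f' ∘ f) (g' ∘ g) = tens f' g' ∘ tens f g;
  tenso_assoc : forall A B D, tenso (tenso A B) D = tenso A (tenso B D);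
  tenso_unit_l : forall A, tenso unit_obj A = A;
  tenso_unit_r : forall A, tenso A unit_obj = A;
  tens_assoc : forall f g h, tens (tens f g) h = tens f (tens g h);
  tens_unit_l : forall f, tens (idm unit_obj) f = f;
  tens_unit_r : forall f, tens f (idm unit_obj) = f
}.

Arguments tenso {s} _ _.
Arguments tens {s} _ _.

Notation "A ⊠ B" := (tenso A B) (at level 40, left associativity) : cat_scope.
Notation "f ⊗ g" := (tens f g) (at level 40, left associativity) : cat_scope.

Record strict_braided_monoidal_category := StrictBraidedMonoidalCategory {
  sbmc_smc :> strict_monoidal_category;
  braid : obj sbmc_smc -> obj sbmc_smc -> mor sbmc_smc;
  braid_hom : forall A B, hom (braid A B) (A ⊠ B) (B ⊠ A);
  braid_iso : forall A B, is_iso (braid A B);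
  braid_natural : forall f g,
    braid (cod f) (cod g) ∘ (f ⊗ g) = (g ⊗ f) ∘ braid (dom f) (dom g);
  braid_tens_r : forall A B D,
    braid A (B ⊠ D) = (B ⊗ braid A D) ∘ (braid A B ⊗ D);
  braid_tens_l : forall A B D,
    braid (A ⊠ B) D = (braid A D ⊗ B) ∘ (A ⊗ braid B D)
}.

Arguments braid {s} _ _.

Record is_algebra (C : strict_braided_monoidal_category) (A : obj C)
    (eta mu : mor C) : Prop := IsAlgebra {
  eta_hom : hom eta (unit_obj C) A;
  mu_hom : hom mu (A ⊠ A) A;
  mu_unit_l : mu ∘ (eta ⊗ A) = A;
  mu_unit_r : mu ∘ (A ⊗ eta) = A;
  mu_assoc : mu ∘ (mu ⊗ A) = mu ∘ (A ⊗ mu)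
}.

Record is_coalgebra (C : strict_braided_monoidal_category) (D : obj C)
    (eps delta : mor C) : Prop := IsCoalgebra {
  eps_hom : hom eps D (unit_obj C);
  delta_hom : hom delta D (D ⊠ D);
  delta_counit_l : (eps ⊗ D) ∘ delta = D;
  delta_counit_r : (D ⊗ eps) ∘ delta = D;
  delta_coassoc : (delta ⊗ D) ∘ delta = (D ⊗ delta) ∘ delta
}.

Record is_coalgebra_morphism (C : strict_braided_monoidal_category)
    (D : obj C) (epsD deltaD : mor C) (E : obj C) (epsE deltaE : mor C)
    (f : mor C) : Prop := IsCoalgebraMorphism {
  coalgm_hom : hom f D E;
  coalgm_eps : epsE ∘ f = epsD;
  coalgm_delta : deltaE ∘ f = (f ⊗ f) ∘ deltaD
}.

Definition tens_delta (C : strict_braided_monoidal_category)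
    (D : obj C) (deltaD : mor C) (E : obj C) (deltaE : mor C) : mor C :=
  (D ⊗ braid D E ⊗ E) ∘ (deltaD ⊗ deltaE).

(** The unit object is a coalgebra whose counit and coproduct are identities. *)
Record is_bialgebra (C : strict_braided_monoidal_category) (H : obj C)
    (eta mu eps delta : mor C) : Prop := IsBialgebra {
  bialg_alg : is_algebra H eta mu;
  bialg_coalg : is_coalgebra H eps delta;
  bialg_eta : is_coalgebra_morphism (unit_obj C) (unit_obj C) (unit_obj C)
    H eps delta eta;
  bialg_mu : is_coalgebra_morphism
    (H ⊠ H) (eps ⊗ eps) (tens_delta H delta H delta) H eps delta mu
}.

Record is_hopf_algebra (C : strict_braided_monoidal_category) (H : obj C)
    (eta mu eps delta lam : mor C) : Prop := IsHopfAlgebra {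
  hopf_bialg : is_bialgebra H eta mu eps delta;
  lam_hom : hom lam H H;
  antipode_r : mu ∘ (H ⊗ lam) ∘ delta = eta ∘ eps;
  antipode_l : mu ∘ (lam ⊗ H) ∘ delta = eta ∘ eps
}.

Record hopf_algebra (C : strict_braided_monoidal_category) := HopfAlgebra {
  ha_obj : obj C;
  ha_eta : mor C;
  ha_mu : mor C;
  ha_eps : mor C;
  ha_delta : mor C;
  ha_lam : mor C;
  ha_axioms : is_hopf_algebra ha_obj ha_eta ha_mu ha_eps ha_delta ha_lam
}.

Definition Gamma_of (C : strict_braided_monoidal_category) (H : obj C)
    (delta mu1 lam1 mu2 : mor C) : mor C :=
  mu1 ∘ (lam1 ⊗ mu2) ∘ (delta ⊗ H).

Record hopf_brace (C : strict_braided_monoidal_category) := HopfBrace {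
  hb_obj : obj C;
  hb_eps : mor C;
  hb_delta : mor C;
  hb_eta1 : mor C;
  hb_mu1 : mor C;
  hb_lam1 : mor C;
  hb_eta2 : mor C;
  hb_mu2 : mor C;
  hb_lam2 : mor C;
  hb_axioms1 : is_hopf_algebra hb_obj hb_eta1 hb_mu1 hb_eps hb_delta hb_lam1;
  hb_axioms2 : is_hopf_algebra hb_obj hb_eta2 hb_mu2 hb_eps hb_delta hb_lam2;
  hb_compat :
    hb_mu2 ∘ (hb_obj ⊗ hb_mu1)
    = hb_mu1 ∘ (hb_mu2 ⊗ Gamma_of hb_obj hb_delta hb_mu1 hb_lam1 hb_mu2)
        ∘ (hb_obj ⊗ braid hb_obj hb_obj ⊗ hb_obj)
        ∘ (hb_delta ⊗ hb_obj ⊗ hb_obj)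
}.

Definition hb_H1 (C : strict_braided_monoidal_category) (B : hopf_brace C) :
    hopf_algebra C :=
  HopfAlgebra (hb_axioms1 B).

Definition hb_H2 (C : strict_braided_monoidal_category) (B : hopf_brace C) :
    hopf_algebra C :=
  HopfAlgebra (hb_axioms2 B).

Definition hb_Gamma1 (C : strict_braided_monoidal_category)
    (B : hopf_brace C) : mor C :=
  Gamma_of (hb_obj B) (hb_delta B) (hb_mu1 B) (hb_lam1 B) (hb_mu2 B).

Definition braided_cocommutative_action (C : strict_braided_monoidal_category)
    (H : obj C) (delta g : mor C) : Prop :=
  (g ⊗ H) ∘ (H ⊗ braid H H) ∘ (delta ⊗ H)
  = (g ⊗ H) ∘ (H ⊗ braid H H) ∘ ((braid H H ∘ delta) ⊗ H).

(** In the last field, and in [bt_lam_inv] below, [inv] is the inverse of the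
    antipode, which exists by an earlier field and is unique. *)
Record is_s_hopf_brace (C : strict_braided_monoidal_category)
    (B : hopf_brace C) : Prop := IsSHopfBrace {
  shb_cocomm : braided_cocommutative_action (hb_obj B) (hb_delta B) (hb_Gamma1 B);
  shb_lam1_iso : is_iso (hb_lam1 B);
  shb_lam2_iso : is_iso (hb_lam2 B);
  shb_lam2_mu :
    hb_mu1 B ∘ (hb_obj B ⊗ hb_Gamma1 B)
      ∘ ((hb_delta B ∘ hb_lam2 B) ⊗ hb_obj B)
    = hb_mu1 B ∘ (hb_obj B ⊗ hb_Gamma1 B)
      ∘ (((hb_lam2 B ⊗ hb_lam2 B) ∘ hb_delta B) ⊗ hb_obj B);
  shb_lam_inv : forall inv, is_inverse (hb_lam1 B) inv ->
    hb_Gamma1 B ∘ (hb_lam2 B ⊗ hb_obj B) ∘ hb_delta B = inv ∘ hb_lam2 B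
}.

Record is_brace_triple_on (C : strict_braided_monoidal_category) (H : obj C)
    (eta mu eps delta lam gamma T : mor C) : Prop := IsBraceTriple {
  bt_lam_iso : is_iso lam;
  bt_gamma_hom : hom gamma (H ⊠ H) H;
  bt_T_hom : hom T H H;
  bt_cocomm : braided_cocommutative_action H delta gamma;
  bt_gamma_coalg : is_coalgebra_morphism
    (H ⊠ H) (eps ⊗ eps) (tens_delta H delta H delta) H eps delta gamma;
  bt_gamma_mu :
    gamma ∘ (H ⊗ mu)
    = mu ∘ (gamma ⊗ gamma) ∘ (H ⊗ braid H H ⊗ H) ∘ (delta ⊗ H ⊗ H);
  bt_gamma_gamma :
    gamma ∘ (H ⊗ gamma)
    = gamma ∘ ((mu ∘ (H ⊗ gamma) ∘ (delta ⊗ H)) ⊗ H);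
  bt_gamma_eta : gamma ∘ (eta ⊗ H) = H;
  bt_T_iso : is_iso T;
  bt_T_delta : delta ∘ T = braid H H ∘ (T ⊗ T) ∘ delta;
  bt_T_eps : eps ∘ T = eps;
  bt_T_mu :
    mu ∘ (H ⊗ gamma) ∘ ((delta ∘ T) ⊗ H)
    = mu ∘ (H ⊗ gamma) ∘ (((T ⊗ T) ∘ delta) ⊗ H);
  bt_gamma_T : gamma ∘ (H ⊗ T) ∘ delta = lam;
  bt_lam_inv : forall inv, is_inverse lam inv ->
    gamma ∘ (T ⊗ H) ∘ delta = inv ∘ T
}.

Definition is_brace_triple (C : strict_braided_monoidal_category)
    (HA : hopf_algebra C) (gamma T : mor C) : Prop :=
  is_brace_triple_on (ha_obj HA) (ha_eta HA) (ha_mu HA) (ha_eps HA)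
    (ha_delta HA) (ha_lam HA) gamma T.

(* Main.v *)
(** Write [f * X] for the convolution [mu ∘ (f ⊗ X) ∘ (delta ⊗ L)].  If [g] is
    a left convolution inverse of [f], then [f * X = f * Y] implies [X = Y].
    Since [mu2 = id * Gamma] in [H1], each identity about [Gamma] follows by
    convolving both sides with a left invertible morphism:
    [id] for compatibility with [mu1], [mu2 : H ⊗ H -> H] (inverse
    [lam1 ∘ mu2]) for the action property, and [delta : H -> H ⊗ H] (inverse
    [delta ∘ lam1]) for compatibility with [delta]; only the last one needs the
    cocommutativity condition.  The same argument with [delta] shows that the
    antipode is anticomultiplicative.  The two units agree because the brace
    equation evaluated at [(eta2, eta1, eta1)] gives [eta1 = lam1 ∘ eta2].

    Equality modulo the axioms of a strict monoidal category is proved by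
    reflection: a composite is cut into layers [u ⊗ f ⊗ v], and layers are
    exchanged until those further left come first. *)

From Stdlib Require Import List Arith.
Require Import Defs.
Import ListNotations.

Local Open Scope bool_scope.
Local Open Scope cat_scope.

(** * Diagrams in strict monoidal categories *)

Section Diagrams.

Context {C : strict_monoidal_category}.
Variable objs : list (obj C).
Variable mors : list (mor C).

Inductive oexp := OVar (n : nat) | OUnit | OTens (a b : oexp).

(** Variables carry their source and target, so composability and normal forms are computed on
    syntax alone; [typed] later asks that the annotations be correct. *)
Inductive texp :=
| TVar (i : nat) (a b : oexp)
| TId (a : oexp)
| TComp (g f : texp)
| TTens (f g : texp).

(** Objects are flattened to words in the object variables, turning strict associativity and unit
    laws into list equalities; [pre] and [post] are the identity strands beside the generator. *)
Record layer := Layer {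
  pre : list nat; label : nat; ldom : list nat; lcod : list nat; post : list nat
}.

Definition nth_obj n : obj C := nth n objs (unit_obj C).
Definition nth_mor i : mor C := nth i mors (idm (unit_obj C)).

Fixpoint oden (e : oexp) : obj C :=
  match e with
  | OVar n => nth_obj n
  | OUnit => unit_obj C
  | OTens a b => oden a ⊠ oden b
  end.

Fixpoint oflat (e : oexp) : list nat :=
  match e with
  | OVar n => [n]
  | OUnit => []
  | OTens a b => oflat a ++ oflat b
  end.

Definition wden (w : list nat) : obj C :=
  fold_right (fun n o => nth_obj n ⊠ o) (unit_obj C) w.

Fixpoint tden (t : texp) : mor C :=
  match t with
  | TVar i _ _ => nth_mor i
  | TId a => idm (oden a)
  | TComp g f => tden g ∘ tden f
  | TTens f g => tden f ⊗ tden g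
  end.

Fixpoint tdom (t : texp) : list nat :=
  match t with
  | TVar _ a _ => oflat a
  | TId a => oflat a
  | TComp _ f => tdom f
  | TTens f g => tdom f ++ tdom g
  end.

Fixpoint tcod (t : texp) : list nat :=
  match t with
  | TVar _ _ b => oflat b
  | TId a => oflat a
  | TComp g _ => tcod g
  | TTens f g => tcod f ++ tcod g
  end.

Definition weqb (u v : list nat) : bool :=
  if list_eq_dec Nat.eq_dec u v then true else false.

Fixpoint composable (t : texp) : bool :=
  match t with
  | TVar _ _ _ | TId _ => true
  | TComp g f => composable g && composable f && weqb (tdom g) (tcod f)
  | TTens f g => composable f && composable g
  end.

Fixpoint typed (t : texp) : Prop :=
  match t with
  | TVar i a b => hom (nth_mor i) (oden a) (oden b)
  | TId _ => True
  | TComp g f => typed g /\ typed f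
  | TTens f g => typed f /\ typed g
  end.

Definition whisker_l (w : list nat) (l : layer) : layer :=
  Layer (w ++ pre l) (label l) (ldom l) (lcod l) (post l).

Definition whisker_r (w : list nat) (l : layer) : layer :=
  Layer (pre l) (label l) (ldom l) (lcod l) (post l ++ w).

(** The head is the layer applied first. A tensor is sequenced as
    [f ⊗ g = (cod f ⊗ g) ∘ (f ⊗ dom g)]. *)
Fixpoint layers (t : texp) : list layer :=
  match t with
  | TVar i a b => [Layer [] i (oflat a) (oflat b) []]
  | TId _ => []
  | TComp g f => layers f ++ layers g
  | TTens f g =>
      map (whisker_r (tdom g)) (layers f) ++ map (whisker_l (tcod f)) (layers g)
  end.

Definition src (l : layer) := pre l ++ ldom l ++ post l.
Definition tgt (l : layer) := pre l ++ lcod l ++ post l.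

Definition layer_den (l : layer) : mor C :=
  wden (pre l) ⊗ (nth_mor (label l) ⊗ wden (post l)).

Fixpoint den (w : list nat) (ls : list layer) : mor C :=
  match ls with
  | [] => idm (wden w)
  | l :: ls => den (tgt l) ls ∘ layer_den l
  end.

Fixpoint chain (w : list nat) (ls : list layer) (w' : list nat) : Prop :=
  match ls with
  | [] => w = w'
  | l :: ls =>
      w = src l /\ hom (nth_mor (label l)) (wden (ldom l)) (wden (lcod l))
      /\ chain (tgt l) ls w'
  end.

(** Succeeds when the inputs of [l2], the later layer, lie wholly to the left of the outputs of
    [l1]; [w] is the word of strands between the two generators. *)
Definition exchange (l1 l2 : layer) : option (layer * layer) :=
  let n := length (pre l2) + length (ldom l2) in
  let w := skipn n (pre l1) in
  if weqb (pre l1) (pre l2 ++ ldom l2 ++ w)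
     && weqb (post l2) (w ++ lcod l1 ++ post l1)
  then Some (Layer (pre l2) (label l2) (ldom l2) (lcod l2)
                   (w ++ ldom l1 ++ post l1),
             Layer (pre l2 ++ lcod l2 ++ w) (label l1) (ldom l1) (lcod l1)
                   (post l1))
  else None.

(** One sweep of a bubble sort. *)
Fixpoint push (l : layer) (ls : list layer) : list layer :=
  match ls with
  | [] => [l]
  | l' :: ls =>
      match exchange l l' with
      | Some (a, b) => a :: push b ls
      | None => l :: push l' ls
      end
  end.

Definition pass (ls : list layer) : list layer :=
  match ls with
  | [] => []
  | l :: ls => push l ls
  end.

(** Incomplete when points and copoints make normal forms non-unique; the number
    of passes is a heuristic bound. *)
Definition normalize (ls : list layer) : list layer :=
  Nat.iter (length ls * length ls) pass ls.

(** * Soundness of the normal form *)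

Lemma weqb_true u v : weqb u v = true -> u = v.
Proof. unfold weqb; destruct list_eq_dec; congruence. Qed.

Lemma wden_app u v : wden (u ++ v) = wden u ⊠ wden v.
Proof.
  induction u as [|n u IH]; simpl.
  - now rewrite tenso_unit_l.
  - now rewrite IH, tenso_assoc.
Qed.

Lemma oden_flat e : oden e = wden (oflat e).
Proof.
  induction e as [n| |a IHa b IHb]; simpl.
  - now rewrite tenso_unit_r.
  - reflexivity.
  - now rewrite IHa, IHb, wden_app.
Qed.

Lemma dom_layer l :
  hom (nth_mor (label l)) (wden (ldom l)) (wden (lcod l)) ->
  dom (layer_den l) = wden (src l).
Proof.
  intros [h _]; unfold layer_den, src.
  now rewrite !dom_tens, !dom_id, !wden_app, h.
Qed.

Lemma cod_layer l :
  hom (nth_mor (label l)) (wden (ldom l)) (wden (lcod l)) ->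
  cod (layer_den l) = wden (tgt l).
Proof.
  intros [_ h]; unfold layer_den, tgt.
  now rewrite !cod_tens, !cod_id, !wden_app, h.
Qed.

Lemma den_hom w ls w' :
  chain w ls w' -> dom (den w ls) = wden w /\ cod (den w ls) = wden w'.
Proof.
  revert w; induction ls as [|l ls IH]; simpl; intros w.
  - intros <-; now rewrite dom_id, cod_id.
  - intros (-> & h & hc); destruct (IH _ hc) as [hd hcd].
    rewrite dom_comp, cod_comp by now rewrite hd, cod_layer.
    now rewrite dom_layer.
Qed.

Lemma chain_app w1 ls1 w2 ls2 w3 :
  chain w1 ls1 w2 -> chain w2 ls2 w3 ->
  chain w1 (ls1 ++ ls2) w3 /\ den w1 (ls1 ++ ls2) = den w2 ls2 ∘ den w1 ls1.
Proof.
  revert w1; induction ls1 as [|l ls1 IH]; simpl; intros w1.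
  - intros -> h; split; [exact h|].
    destruct (den_hom _ _ _ h) as [hd _].
    now rewrite <- hd, comp_id_r.
  - intros (-> & h & h1) h2.
    destruct (IH _ h1 h2) as [hc ->].
    destruct (den_hom _ _ _ h1), (den_hom _ _ _ h2).
    repeat split; auto; try apply h.
    rewrite comp_assoc; auto; try congruence.
    now rewrite cod_layer.
Qed.

Lemma chain_whisker_r u w ls w' :
  chain w ls w' ->
  chain (w ++ u) (map (whisker_r u) ls) (w' ++ u) /\
  den (w ++ u) (map (whisker_r u) ls) = den w ls ⊗ wden u.
Proof.
  revert w; induction ls as [|l ls IH]; simpl; intros w.
  - intros ->; split; [reflexivity|].
    now rewrite tens_id, wden_app.
  - intros (-> & h & hc); destruct (IH _ hc) as [h1 h2].
    assert (ht : tgt (whisker_r u l) = tgt l ++ u).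
    { unfold tgt; simpl; now rewrite <- !app_assoc. }
    rewrite ht, h2.
    repeat split; auto; try apply h.
    + unfold src; simpl; now rewrite <- !app_assoc.
    + destruct (den_hom _ _ _ hc) as [hd _].
      transitivity ((den (tgt l) ls ⊗ wden u) ∘ (layer_den l ⊗ wden u)).
      * f_equal; unfold layer_den; simpl.
        now rewrite !tens_assoc, tens_id, wden_app.
      * rewrite <- tens_comp.
        -- f_equal. rewrite <- (dom_id (wden u)) at 2. apply comp_id_r.
        -- now rewrite hd, cod_layer.
        -- now rewrite dom_id, cod_id.
Qed.

Lemma chain_whisker_l u w ls w' :
  chain w ls w' ->
  chain (u ++ w) (map (whisker_l u) ls) (u ++ w') /\
  den (u ++ w) (map (whisker_l u) ls) = wden u ⊗ den w ls.
Proof.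
  revert w; induction ls as [|l ls IH]; simpl; intros w.
  - intros ->; split; [reflexivity|].
    now rewrite tens_id, wden_app.
  - intros (-> & h & hc); destruct (IH _ hc) as [h1 h2].
    assert (ht : tgt (whisker_l u l) = u ++ tgt l).
    { unfold tgt; simpl; now rewrite <- !app_assoc. }
    rewrite ht, h2.
    repeat split; auto; try apply h.
    + unfold src; simpl; now rewrite <- !app_assoc.
    + destruct (den_hom _ _ _ hc) as [hd _].
      transitivity ((wden u ⊗ den (tgt l) ls) ∘ (wden u ⊗ layer_den l)).
      * f_equal; unfold layer_den; simpl.
        now rewrite wden_app, <- tens_id, !tens_assoc.
      * rewrite <- tens_comp.
        -- f_equal. rewrite <- (dom_id (wden u)) at 2. apply comp_id_r.
        -- now rewrite dom_id, cod_id.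
        -- now rewrite hd, cod_layer.
Qed.

Lemma layers_sound t :
  composable t = true -> typed t ->
  chain (tdom t) (layers t) (tcod t) /\ tden t = den (tdom t) (layers t).
Proof.
  induction t as [i a b|a|g IHg f IHf|f IHf g IHg]; simpl.
  - intros _ [h1 h2]; unfold src, tgt, hom; simpl.
    rewrite !app_nil_r, <- !oden_flat.
    repeat split; auto.
    unfold layer_den; simpl.
    rewrite tens_unit_r, tens_unit_l, <- h2.
    now rewrite comp_id_l.
  - intros _ _; split; [reflexivity|]. now rewrite oden_flat.
  - intros hb [hg hf].
    apply andb_prop in hb as [hb he]; apply andb_prop in hb as [hbg hbf].
    apply weqb_true in he.
    destruct (IHg hbg hg) as [cg ->], (IHf hbf hf) as [cf ->].
    rewrite he in *.
    destruct (chain_app _ _ _ _ _ cf cg); auto.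
  - intros hb [hf hg]; apply andb_prop in hb as [hbf hbg].
    destruct (IHg hbg hg) as [cg ->], (IHf hbf hf) as [cf ->].
    destruct (chain_whisker_r (tdom g) _ _ _ cf) as [c1 e1].
    destruct (chain_whisker_l (tcod f) _ _ _ cg) as [c2 e2].
    destruct (chain_app _ _ _ _ _ c1 c2) as [c3 e3].
    split; [exact c3|].
    rewrite e3, e1, e2.
    destruct (den_hom _ _ _ cf), (den_hom _ _ _ cg).
    rewrite <- tens_comp by now rewrite ?dom_id, ?cod_id.
    f_equal.
    + symmetry; rewrite <- H0; apply comp_id_l.
    + symmetry; rewrite <- H1; apply comp_id_r.
Qed.

Lemma exchange_sound l1 l2 a b w ls w' :
  exchange l1 l2 = Some (a, b) -> chain w (l1 :: l2 :: ls) w' ->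
  chain w (a :: b :: ls) w' /\ den w (l1 :: l2 :: ls) = den w (a :: b :: ls).
Proof.
  unfold exchange.
  destruct l1 as [p1 i1 d1 c1 q1], l2 as [p2 i2 d2 c2 q2]; simpl.
  set (v := skipn _ _); clearbody v.
  destruct andb eqn:e; [|discriminate].
  apply andb_prop in e as [e1 e2].
  apply weqb_true in e1, e2; injection 1 as <- <-; subst p1 q2.
  unfold src, tgt; simpl.
  intros (-> & h1 & _ & h2 & hc).
  rewrite <- !app_assoc in *; simpl.
  repeat split; auto; try apply h1; try apply h2.
  set (X := den _ ls).
  assert (hX : dom X = wden (p2 ++ c2 ++ v ++ c1 ++ q1)).
  { subst X; destruct (den_hom _ _ _ hc) as [-> _]; now rewrite !app_assoc. }
  clearbody X.
  unfold layer_den; simpl.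
  destruct h1 as [h1d h1c], h2 as [h2d h2c].
  rewrite <- !comp_assoc;
    rewrite ?dom_tens, ?cod_tens, ?dom_id, ?cod_id, ?h1d, ?h1c, ?h2d, ?h2c, ?hX,
      ?wden_app, ?tenso_assoc; auto.
  f_equal.
  (* With the common tail removed, interchange merges each side strand by strand; every factor is
     then a generator or an identity composed with identities. *)
  rewrite <- !tens_id, !tens_assoc.
  rewrite <- !tens_comp
    by (rewrite ?dom_tens, ?cod_tens, ?dom_id, ?cod_id, ?h1d, ?h1c, ?h2d, ?h2c;
        auto).
  f_equal.
  now rewrite <- h1d, <- h1c, <- h2d, <- h2c, !comp_id_l, !comp_id_r.
Qed.

Lemma push_sound l ls w w' :
  chain w (l :: ls) w' ->
  chain w (push l ls) w' /\ den w (l :: ls) = den w (push l ls).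
Proof.
  revert l w; induction ls as [|l' ls IH]; intros l w h; [easy|].
  cbn [push]; destruct (exchange l l') as [[a b]|] eqn:e.
  - destruct (exchange_sound _ _ _ _ _ _ _ e h) as [h' ->].
    destruct h' as (-> & ha & h').
    destruct (IH _ _ h') as [hc he].
    split; [now repeat split; try apply ha|].
    change (den (tgt a) (b :: ls) ∘ layer_den a
            = den (tgt a) (push b ls) ∘ layer_den a).
    now rewrite he.
  - destruct h as (-> & ha & h').
    destruct (IH _ _ h') as [hc he].
    split; [now repeat split; try apply ha|].
    change (den (tgt l) (l' :: ls) ∘ layer_den l
            = den (tgt l) (push l' ls) ∘ layer_den l).
    now rewrite he.
Qed.

Lemma normalize_sound ls w w' :
  chain w ls w' -> den w ls = den w (normalize ls).
Proof.
  intros h; unfold normalize.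
  enough (chain w (Nat.iter (length ls * length ls) pass ls) w' /\
    den w ls = den w (Nat.iter (length ls * length ls) pass ls)) by easy.
  induction (length ls * length ls) as [|n [hc ->]]; [easy|].
  simpl; destruct (Nat.iter n pass ls) as [|l r]; [easy|].
  now apply push_sound.
Qed.

(** Domains are compared as well, because an empty list of layers does not tell which identity it
    denotes. *)
Lemma diagram_eq t1 t2 :
  composable t1 && composable t2 = true ->
  (tdom t1, normalize (layers t1)) = (tdom t2, normalize (layers t2)) ->
  typed t1 -> typed t2 -> tden t1 = tden t2.
Proof.
  intros hb he h1 h2; apply andb_prop in hb as [hb1 hb2].
  destruct (layers_sound _ hb1 h1) as [c1 ->].
  destruct (layers_sound _ hb2 h2) as [c2 ->].
  rewrite (normalize_sound _ _ _ c1), (normalize_sound _ _ _ c2).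
  now injection he as -> ->.
Qed.

Lemma diagram_hom t a b :
  composable t = true -> (tdom t, tcod t) = (oflat a, oflat b) ->
  typed t -> hom (tden t) (oden a) (oden b).
Proof.
  intros hb he h; destruct (layers_sound _ hb h) as [c ->].
  destruct (den_hom _ _ _ c) as [h1 h2].
  injection he as e1 e2.
  now rewrite e1 in *; rewrite e2 in *; split; rewrite oden_flat.
Qed.

End Diagrams.

(** * Reification of morphisms and objects *)

Ltac lookup x l :=
  lazymatch l with
  | x :: _ => constr:(O)
  | _ :: ?l => let n := lookup x l in constr:(S n)
  end.

Ltac insert x l :=
  let rec mem l' :=
    lazymatch l' with
    | nil => constr:(false)
    | x :: _ => constr:(true)
    | _ :: ?l'' => mem l''
    end in
  lazymatch mem l with
  | true => l
  | false => constr:(x :: l)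
  end.

Ltac add_obj A l :=
  lazymatch A with
  | unit_obj _ => l
  | ?A ⊠ ?B => let l := add_obj A l in add_obj B l
  | _ => insert A l
  end.

(** Types of generators are read off [hom] hypotheses, which is why proofs unpack their structures
    before calling [mon]. *)
Ltac type_of_mor f :=
  match goal with
  | _ : hom f ?A ?B |- _ => constr:((A, B))
  | _ => lazymatch f with @braid _ ?A ?B => constr:((A ⊠ B, B ⊠ A)) end
  end.

Ltac add_objs f l :=
  lazymatch f with
  | idm ?A => add_obj A l
  | ?g ∘ ?f => let l := add_objs g l in add_objs f l
  | ?g ⊗ ?f => let l := add_objs g l in add_objs f l
  | _ => lazymatch type_of_mor f with (?A, ?B) =>
           let l := add_obj A l in add_obj B l end
  end.

Ltac add_mors f l :=
  lazymatch f with
  | idm _ => l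
  | ?g ∘ ?f => let l := add_mors g l in add_mors f l
  | ?g ⊗ ?f => let l := add_mors g l in add_mors f l
  | _ => insert f l
  end.

Ltac reify_obj A l :=
  lazymatch A with
  | unit_obj _ => constr:(OUnit)
  | ?A ⊠ ?B => let a := reify_obj A l in let b := reify_obj B l in
               constr:(OTens a b)
  | _ => let n := lookup A l in constr:(OVar n)
  end.

Ltac reify f lo lm :=
  lazymatch f with
  | idm ?A => let a := reify_obj A lo in constr:(TId a)
  | ?g ∘ ?f => let s := reify g lo lm in let t := reify f lo lm in
               constr:(TComp s t)
  | ?g ⊗ ?f => let s := reify g lo lm in let t := reify f lo lm in
               constr:(TTens s t)
  | _ => lazymatch type_of_mor f with (?A, ?B) =>
           let a := reify_obj A lo in let b := reify_obj B lo in
           let i := lookup f lm in constr:(TVar i a b) end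
  end.

Ltac solve_typed :=
  cbn [typed];
  repeat lazymatch goal with |- _ /\ _ => apply conj | |- True => exact I end;
  first [assumption | apply braid_hom].

Ltac mon :=
  lazymatch goal with
  | |- @eq (mor ?C) ?f ?g =>
      let lo := add_objs f (@nil (obj C)) in
      let lo := add_objs g lo in
      let lm := add_mors f (@nil (mor C)) in
      let lm := add_mors g lm in
      let s := reify f lo lm in
      let t := reify g lo lm in
      refine (diagram_eq lo lm s t _ _ _ _);
      [ vm_compute; reflexivity | vm_compute; reflexivity
      | solve_typed | solve_typed ]
  | |- @hom ?C ?f ?A ?B =>
      let lo := add_objs f (@nil (obj C)) in
      let lo := add_obj A lo in
      let lo := add_obj B lo in
      let lm := add_mors f (@nil (mor C)) in
      let s := reify f lo lm in
      let a := reify_obj A lo in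
      let b := reify_obj B lo in
      refine (diagram_hom lo lm s a b _ _ _);
      [ vm_compute; reflexivity | vm_compute; reflexivity | solve_typed ]
  end.

(* Calculations alternate [to], which exposes one side of an axiom as a literal subterm, with a
   rewrite by that axiom. Braidings are opaque generators here, so naturality is always an explicit
   rewrite. *)
Tactic Notation "to" constr(t) := transitivity t; [mon|].

(** * Convolution and antipodes *)

Section Braided.

Context {C : strict_braided_monoidal_category}.

(** Associativity of convolution: [g * (f * X) = (g * f) * X = (eta ∘ eps) * X = X]. *)
Lemma conv_cancel (A D L : obj C) eta mu eps delta f g X :
  is_algebra A eta mu -> is_coalgebra D eps delta ->
  hom f D A -> hom g D A -> hom X (D ⊠ L) A ->
  mu ∘ (g ⊗ f) ∘ delta = eta ∘ eps ->
  mu ∘ (g ⊗ (mu ∘ (f ⊗ X) ∘ (delta ⊗ L))) ∘ (delta ⊗ L) = X.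
Proof.
  intros [he hm ul _ ass] [hep hd cul _ coass] hf hg hX inv.
  to ((mu ∘ (A ⊗ mu)) ∘ (g ⊗ f ⊗ X) ∘ (((D ⊗ delta) ∘ delta) ⊗ L)).
  rewrite <- ass, <- coass.
  to (mu ∘ ((mu ∘ (g ⊗ f) ∘ delta) ⊗ X) ∘ (delta ⊗ L)).
  rewrite inv.
  to ((mu ∘ (eta ⊗ A)) ∘ X ∘ (((eps ⊗ D) ∘ delta) ⊗ L)).
  rewrite ul, cul. mon.
Qed.

Lemma conv_cancel_l (A D L : obj C) eta mu eps delta f g X Y :
  is_algebra A eta mu -> is_coalgebra D eps delta ->
  hom f D A -> hom g D A -> mu ∘ (g ⊗ f) ∘ delta = eta ∘ eps ->
  hom X (D ⊠ L) A -> hom Y (D ⊠ L) A ->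
  mu ∘ (f ⊗ X) ∘ (delta ⊗ L) = mu ∘ (f ⊗ Y) ∘ (delta ⊗ L) -> X = Y.
Proof.
  intros hA hD hf hg inv hX hY e.
  rewrite <- (conv_cancel _ _ _ _ _ _ _ _ _ _ hA hD hf hg hX inv), e.
  now apply (conv_cancel _ _ _ _ _ _ _ _ _ _ hA hD hf hg hY inv).
Qed.

(** * The braiding against units, products and coproducts *)

Lemma iso_idempotent (A : obj C) b : hom b A A -> is_iso b -> b = b ∘ b -> b = A.
Proof.
  intros hb (g & hg & e & _) eb.
  destruct hb as [hd hc]; rewrite hd, hc in *.
  assert (hb : hom b A A) by easy.
  to (idm A ∘ b). rewrite <- e.
  to (g ∘ (b ∘ b)). now rewrite <- eb.
Qed.

(** Since [K ⊗ K = K], the hexagon makes this braiding idempotent, and it is invertible. *)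
Lemma braid_unit_l (A : obj C) : braid (unit_obj C) A = A.
Proof.
  apply iso_idempotent; [mon|apply braid_iso|].
  rewrite <- (tenso_unit_l (unit_obj C)) at 1.
  rewrite braid_tens_l. mon.
Qed.

Lemma braid_unit_r (A : obj C) : braid A (unit_obj C) = A.
Proof.
  apply iso_idempotent; [mon|apply braid_iso|].
  rewrite <- (tenso_unit_l (unit_obj C)) at 1.
  rewrite braid_tens_r. mon.
Qed.

Lemma braid_nat f g (A A' B B' : obj C) : hom f A A' -> hom g B B' ->
  braid A' B' ∘ (f ⊗ g) = (g ⊗ f) ∘ braid A B.
Proof. intros [<- <-] [<- <-]; apply braid_natural. Qed.

Lemma hom_id (A : obj C) : hom A A A.
Proof. mon. Qed.

(** Here and in the next seven lemmas, naturality slides [f] past the strand [D]; the hexagon splits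
    the crossing with [A ⊠ B], and a crossing with the unit object disappears. *)
Lemma braid_mul_l f (A B E D : obj C) : hom f (A ⊠ B) E ->
  braid E D ∘ (f ⊗ D) = (D ⊗ f) ∘ (braid A D ⊗ B) ∘ (A ⊗ braid B D).
Proof.
  intros hf; rewrite (braid_nat _ _ _ _ _ _ hf (hom_id D)), braid_tens_l; mon.
Qed.

Lemma braid_mul_r f (A B E D : obj C) : hom f (A ⊠ B) E ->
  braid D E ∘ (D ⊗ f) = (f ⊗ D) ∘ (A ⊗ braid D B) ∘ (braid D A ⊗ B).
Proof.
  intros hf; rewrite (braid_nat _ _ _ _ _ _ (hom_id D) hf), braid_tens_r; mon.
Qed.

Lemma braid_comul_l f (A B E D : obj C) : hom f E (A ⊠ B) ->
  (D ⊗ f) ∘ braid E D = (braid A D ⊗ B) ∘ (A ⊗ braid B D) ∘ (f ⊗ D).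
Proof.
  intros hf; rewrite <- (braid_nat _ _ _ _ _ _ hf (hom_id D)), braid_tens_l; mon.
Qed.

Lemma braid_comul_r f (A B E D : obj C) : hom f E (A ⊠ B) ->
  (f ⊗ D) ∘ braid D E = (A ⊗ braid D B) ∘ (braid D A ⊗ B) ∘ (D ⊗ f).
Proof.
  intros hf; rewrite <- (braid_nat _ _ _ _ _ _ (hom_id D) hf), braid_tens_r; mon.
Qed.

Lemma braid_point_l f (E D : obj C) : hom f (unit_obj C) E ->
  braid E D ∘ (f ⊗ D) = D ⊗ f.
Proof.
  intros hf; rewrite (braid_nat _ _ _ _ _ _ hf (hom_id D)), braid_unit_l; mon.
Qed.

Lemma braid_point_r f (E D : obj C) : hom f (unit_obj C) E ->
  braid D E ∘ (D ⊗ f) = f ⊗ D.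
Proof.
  intros hf; rewrite (braid_nat _ _ _ _ _ _ (hom_id D) hf), braid_unit_r; mon.
Qed.

Lemma braid_copoint_l f (E D : obj C) : hom f E (unit_obj C) ->
  (D ⊗ f) ∘ braid E D = f ⊗ D.
Proof.
  intros hf; rewrite <- (braid_nat _ _ _ _ _ _ hf (hom_id D)), braid_unit_l; mon.
Qed.

Lemma braid_copoint_r f (E D : obj C) : hom f E (unit_obj C) ->
  (f ⊗ D) ∘ braid D E = D ⊗ f.
Proof.
  intros hf; rewrite <- (braid_nat _ _ _ _ _ _ (hom_id D) hf), braid_unit_r; mon.
Qed.

(** * Tensor squares and the antipode *)

Lemma tens_algebra (A : obj C) eta mu : is_algebra A eta mu ->
  is_algebra (A ⊠ A) (eta ⊗ eta) ((mu ⊗ mu) ∘ (A ⊗ braid A A ⊗ A)).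
Proof.
  intros [he hm ul ur ass]; split; [mon|mon| | |].
  - to ((mu ⊗ mu) ∘ (eta ⊗ (braid A A ∘ (eta ⊗ A)) ⊗ A)).
    rewrite (braid_point_l _ _ _ he).
    to ((mu ∘ (eta ⊗ A)) ⊗ (mu ∘ (eta ⊗ A))).
    rewrite ul; mon.
  - to ((mu ⊗ mu) ∘ (A ⊗ (braid A A ∘ (A ⊗ eta)) ⊗ eta)).
    rewrite (braid_point_r _ _ _ he).
    to ((mu ∘ (A ⊗ eta)) ⊗ (mu ∘ (A ⊗ eta))).
    rewrite ur; mon.
  (* Pulling [mu] through the crossing gathers two copies of [mu ∘ (mu ⊗ A)]; both are reassociated,
     and a product is then pushed back through a crossing. *)
  - to ((mu ⊗ mu) ∘ (mu ⊗ (braid A A ∘ (mu ⊗ A)) ⊗ A) ∘ (A ⊗ braid A A ⊗ A ⊗ A ⊗ A)).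
    rewrite (braid_mul_l _ _ _ _ _ hm).
    to (((mu ∘ (mu ⊗ A)) ⊗ (mu ∘ (mu ⊗ A))) ∘ (A ⊗ A ⊗ braid A A ⊗ A ⊗ A)
        ∘ (A ⊗ braid A A ⊗ braid A A ⊗ A)).
    rewrite ass.
    to ((mu ⊗ mu) ∘ (A ⊗ ((mu ⊗ A) ∘ (A ⊗ braid A A) ∘ (braid A A ⊗ A)) ⊗ mu)
        ∘ (A ⊗ A ⊗ A ⊗ braid A A ⊗ A)).
    rewrite <- (braid_mul_r _ _ _ _ _ hm). mon.
Qed.

(** The argument of [tens_algebra] with all diagrams reversed. *)
Lemma tens_coalgebra (D : obj C) eps delta : is_coalgebra D eps delta ->
  is_coalgebra (D ⊠ D) (eps ⊗ eps) (tens_delta D delta D delta).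
Proof.
  unfold tens_delta; intros [he hd ul ur coass]; split; [mon|mon| | |].
  - to ((eps ⊗ ((eps ⊗ D) ∘ braid D D) ⊗ D) ∘ (delta ⊗ delta)).
    rewrite (braid_copoint_r _ _ _ he).
    to (((eps ⊗ D) ∘ delta) ⊗ ((eps ⊗ D) ∘ delta)).
    rewrite ul; mon.
  - to ((D ⊗ ((D ⊗ eps) ∘ braid D D) ⊗ eps) ∘ (delta ⊗ delta)).
    rewrite (braid_copoint_l _ _ _ he).
    to (((D ⊗ eps) ∘ delta) ⊗ ((D ⊗ eps) ∘ delta)).
    rewrite ur; mon.
  - to ((D ⊗ braid D D ⊗ D ⊗ D ⊗ D) ∘ (delta ⊗ ((delta ⊗ D) ∘ braid D D) ⊗ D)
        ∘ (delta ⊗ delta)).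
    rewrite (braid_comul_r _ _ _ _ _ hd).
    to ((D ⊗ braid D D ⊗ braid D D ⊗ D) ∘ (D ⊗ D ⊗ braid D D ⊗ D ⊗ D)
        ∘ (((delta ⊗ D) ∘ delta) ⊗ ((delta ⊗ D) ∘ delta))).
    rewrite coass.
    to ((D ⊗ D ⊗ D ⊗ braid D D ⊗ D)
        ∘ (D ⊗ ((braid D D ⊗ D) ∘ (D ⊗ braid D D) ∘ (delta ⊗ D)) ⊗ delta)
        ∘ (delta ⊗ delta)).
    rewrite <- (braid_comul_l _ _ _ _ _ hd). mon.
Qed.

(** Composing with the algebra morphism [delta] preserves convolution products and units. *)
Lemma bialgebra_comul_conv_inv (H : obj C) eta mu eps delta f g :
  is_bialgebra H eta mu eps delta -> hom f H H -> hom g H H ->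
  mu ∘ (f ⊗ g) ∘ delta = eta ∘ eps ->
  (mu ⊗ mu) ∘ (H ⊗ braid H H ⊗ H) ∘ ((delta ∘ f) ⊗ (delta ∘ g)) ∘ delta
  = (eta ⊗ eta) ∘ eps.
Proof.
  intros [[he hm _ _ _] [hep hd _ _ _] [_ _ de] [_ _ dm]] hf hg inv.
  unfold tens_delta in dm.
  to ((mu ⊗ mu) ∘ ((H ⊗ braid H H ⊗ H) ∘ (delta ⊗ delta)) ∘ (f ⊗ g) ∘ delta).
  rewrite <- dm.
  to (delta ∘ (mu ∘ (f ⊗ g) ∘ delta)). rewrite inv.
  to ((delta ∘ eta) ∘ eps). rewrite de. mon.
Qed.

(** Both sides are right convolution inverses of [delta], which has the left inverse
    [delta ∘ lam]. *)
Lemma comul_antipode (H : obj C) eta mu eps delta lam :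
  is_hopf_algebra H eta mu eps delta lam ->
  delta ∘ lam = braid H H ∘ (lam ⊗ lam) ∘ delta.
Proof.
  intros [bi hl ar al].
  pose proof bi as [hA hD _ _].
  pose proof (tens_algebra _ _ _ hA) as hAA.
  pose proof hA as [he hm ul _ ass].
  pose proof hD as [hep hd cul cur coass].
  apply (conv_cancel_l (H ⊠ H) H (unit_obj C) _ _ _ _ delta (delta ∘ lam) _ _ hAA hD);
    [mon|mon| |mon|mon|].
  - rewrite <- (bialgebra_comul_conv_inv _ _ _ _ _ _ _ bi hl (hom_id H) al). mon.
  - transitivity ((eta ⊗ eta) ∘ eps).
    + rewrite <- (bialgebra_comul_conv_inv _ _ _ _ _ _ _ bi (hom_id H) hl ar). mon.
    + symmetry.
      (* Up to braidings the product is [h1 lam(h4) ⊗ h2 lam(h3)]: the inner pair collapses first,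
         then the outer one. *)
      to ((mu ⊗ H) ∘ (H ⊗ ((H ⊗ mu) ∘ (braid H H ⊗ H) ∘ (H ⊗ braid H H)))
          ∘ (delta ⊗ ((lam ⊗ lam) ∘ delta)) ∘ delta).
      rewrite <- (braid_mul_l _ _ _ _ _ hm).
      to ((mu ⊗ H) ∘ (H ⊗ (braid H H ∘ ((mu ∘ (H ⊗ lam)) ⊗ lam)))
          ∘ (H ⊗ H ⊗ delta) ∘ ((delta ⊗ H) ∘ delta)).
      rewrite coass.
      to ((mu ⊗ H) ∘ (H ⊗ (braid H H ∘ ((mu ∘ (H ⊗ lam)) ⊗ lam)))
          ∘ (H ⊗ ((H ⊗ delta) ∘ delta)) ∘ delta).
      rewrite <- coass.
      to ((mu ⊗ H) ∘ (H ⊗ (braid H H ∘ ((mu ∘ (H ⊗ lam) ∘ delta) ⊗ lam) ∘ delta))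
          ∘ delta).
      rewrite ar.
      to ((mu ⊗ H) ∘ (H ⊗ ((braid H H ∘ (eta ⊗ H)) ∘ lam ∘ ((eps ⊗ H) ∘ delta)))
          ∘ delta).
      rewrite (braid_point_l _ _ _ he), cul.
      to ((mu ∘ (H ⊗ lam) ∘ delta) ⊗ eta).
      rewrite ar. mon.
Qed.

(** [eps(lam(h)) = eps(h1) eps(lam(h2)) = eps(h1 lam(h2)) = eps(h)]. *)
Lemma counit_antipode (H : obj C) eta mu eps delta lam :
  is_hopf_algebra H eta mu eps delta lam -> eps ∘ lam = eps.
Proof.
  intros [[[he hm _ _ _] [hep hd cul _ _] [_ ee _] [_ em _]] hl ar _].
  to (eps ∘ lam ∘ idm H). rewrite <- cul.
  to ((eps ⊗ eps) ∘ (H ⊗ lam) ∘ delta). rewrite <- em.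
  to (eps ∘ (mu ∘ (H ⊗ lam) ∘ delta)). rewrite ar.
  to ((eps ∘ eta) ∘ eps). rewrite ee. mon.
Qed.

End Braided.

(** * Hopf braces *)

Section Brace.

(** [G] is a variable tied to its formula by an equation, so that [mon] treats it as a generator. *)
Context {C : strict_braided_monoidal_category} (H : obj C)
  (eps delta eta1 mu1 lam1 eta2 mu2 lam2 G : mor C)
  (hopf1 : is_hopf_algebra H eta1 mu1 eps delta lam1)
  (hopf2 : is_hopf_algebra H eta2 mu2 eps delta lam2)
  (G_def : G = Gamma_of H delta mu1 lam1 mu2)
  (compat : mu2 ∘ (H ⊗ mu1)
    = mu1 ∘ (mu2 ⊗ G) ∘ (H ⊗ braid H H ⊗ H) ∘ (delta ⊗ H ⊗ H)).

Lemma Gamma_hom : hom G (H ⊠ H) H.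
Proof using hopf1 hopf2 G_def.
  destruct hopf1 as [[[] [] _ _] hl _ _], hopf2 as [[[] _ _ _] _ _ _].
  rewrite G_def; unfold Gamma_of; mon.
Qed.

Ltac unpack :=
  pose proof Gamma_hom as hG;
  pose proof hopf1 as
    [[[he1 hm1 ul1 ur1 ass1] [hep hd cul cur coass] [_ ee1 de1] [_ em1 dm1]] hl1 ar1 al1];
  pose proof hopf2 as
    [[[he2 hm2 ul2 ur2 ass2] _ [_ ee2 de2] [_ em2 dm2]] hl2 ar2 al2];
  unfold tens_delta in dm1, dm2.

Lemma brace_units : eta1 = eta2.
Proof using All.
  unpack.
  assert (e : eta1 = lam1 ∘ eta2).
  (* The two identities are placeholders, expanded by unit laws into [mu2(eta2, mu1(eta1, eta1))].
     The brace equation reduces this to [G(eta2, eta1)], which the formula for [G] turns into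
     [lam1(eta2)]. *)
  { to (idm H ∘ idm H ∘ eta1).
    rewrite <- ul1 at 2. rewrite <- ul2 at 1.
    to ((mu2 ∘ (H ⊗ mu1)) ∘ (eta2 ⊗ eta1 ⊗ eta1)). rewrite compat.
    to (mu1 ∘ (mu2 ⊗ G) ∘ (H ⊗ braid H H ⊗ H) ∘ ((delta ∘ eta2) ⊗ eta1 ⊗ eta1)).
    rewrite de2.
    to (mu1 ∘ (mu2 ⊗ G) ∘ (eta2 ⊗ (braid H H ∘ (eta2 ⊗ H)) ⊗ H) ∘ (eta1 ⊗ eta1)).
    rewrite (braid_point_l _ _ _ he2).
    to (mu1 ∘ ((mu2 ∘ (eta2 ⊗ H)) ⊗ G) ∘ (eta1 ⊗ (eta2 ⊗ eta1))).
    rewrite ul2.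
    to ((mu1 ∘ (eta1 ⊗ H)) ∘ G ∘ (eta2 ⊗ eta1)).
    rewrite ul1, G_def; unfold Gamma_of.
    to (mu1 ∘ (lam1 ⊗ mu2) ∘ ((delta ∘ eta2) ⊗ eta1)). rewrite de2.
    to (mu1 ∘ ((lam1 ∘ eta2) ⊗ ((mu2 ∘ (eta2 ⊗ H)) ∘ eta1))). rewrite ul2.
    to ((mu1 ∘ (H ⊗ eta1)) ∘ lam1 ∘ eta2). rewrite ur1. mon. }
  (* As [eta2] is grouplike, [eta2 = mu1(eta1, eta2) = mu1(lam1(eta2), eta2) = eta1]. *)
  symmetry. to (idm H ∘ eta2). rewrite <- ul1.
  to (mu1 ∘ (eta1 ⊗ eta2)). rewrite e at 1.
  to (mu1 ∘ (lam1 ⊗ H) ∘ ((eta2 ⊗ eta2) ∘ unit_obj C)). rewrite <- de2.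
  to ((mu1 ∘ (lam1 ⊗ H) ∘ delta) ∘ eta2). rewrite al1.
  to (eta1 ∘ (eps ∘ eta2)). rewrite ee2. mon.
Qed.

Lemma mul2_Gamma : mu1 ∘ (H ⊗ G) ∘ (delta ⊗ H) = mu2.
Proof using hopf1 hopf2 G_def.
  rewrite G_def; unfold Gamma_of; unpack.
  apply (conv_cancel H H H eta1 mu1 eps delta lam1 H mu2); auto;
    [apply hopf1|apply hopf1|mon].
Qed.

(** Expanding [G] leaves [lam1(h1)] times [mu2(h2, lam2(h3))]; the latter is [eta2], which [mu1]
    absorbs because the units agree. *)
Lemma Gamma_antipode : G ∘ (H ⊗ lam2) ∘ delta = lam1.
Proof using All.
  unpack. rewrite G_def; unfold Gamma_of.
  to (mu1 ∘ (lam1 ⊗ mu2) ∘ (H ⊗ H ⊗ lam2) ∘ ((delta ⊗ H) ∘ delta)).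
  rewrite coass.
  to (mu1 ∘ (lam1 ⊗ (mu2 ∘ (H ⊗ lam2) ∘ delta)) ∘ delta).
  rewrite ar2, <- brace_units.
  to ((mu1 ∘ (H ⊗ eta1)) ∘ lam1 ∘ ((H ⊗ eps) ∘ delta)).
  rewrite ur1, cur. mon.
Qed.

Lemma Gamma_unit : G ∘ (eta1 ⊗ H) = H.
Proof using All.
  unpack.
  transitivity ((mu1 ∘ (eta1 ⊗ H)) ∘ G ∘ (eta1 ⊗ H)); [rewrite ul1; mon|].
  to (mu1 ∘ (H ⊗ G) ∘ (((eta1 ⊗ eta1) ∘ unit_obj C) ⊗ H)).
  rewrite <- de1.
  to ((mu1 ∘ (H ⊗ G) ∘ (delta ⊗ H)) ∘ (eta1 ⊗ H)).
  now rewrite mul2_Gamma, brace_units.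
Qed.

(** Convolved with the identity, this is the brace equation with [mu2] written as [id * G]. *)
Lemma Gamma_mul :
  G ∘ (H ⊗ mu1) = mu1 ∘ (G ⊗ G) ∘ (H ⊗ braid H H ⊗ H) ∘ (delta ⊗ H ⊗ H).
Proof using All.
  unpack.
  apply (conv_cancel_l H H (H ⊠ H) eta1 mu1 eps delta H lam1); auto;
    [apply hopf1|apply hopf1|mon|mon|mon|].
  to ((mu1 ∘ (H ⊗ G) ∘ (delta ⊗ H)) ∘ (H ⊗ mu1)).
  rewrite mul2_Gamma, compat, <- mul2_Gamma.
  to ((mu1 ∘ (mu1 ⊗ H)) ∘ (H ⊗ G ⊗ G) ∘ (H ⊗ H ⊗ braid H H ⊗ H)
      ∘ (((delta ⊗ H) ∘ delta) ⊗ H ⊗ H)).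
  rewrite ass1, coass. mon.
Qed.

(** Write [·] for [mu1] and juxtaposition for [mu2]. Up to braidings, [(h1 k1)·G(h2, G(k2, l)) = h
    (k1·G(k2, l)) = h (k l) = (h k) l = (h1 k1)·G(h2 k2, l)]; the first equality is the brace
    equation read backwards. *)
Lemma Gamma_action : G ∘ (H ⊗ G) = G ∘ ((mu1 ∘ (H ⊗ G) ∘ (delta ⊗ H)) ⊗ H).
Proof using All.
  unpack.
  rewrite mul2_Gamma.
  apply (conv_cancel_l H (H ⊠ H) H eta1 mu1 (eps ⊗ eps) (tens_delta H delta H delta)
    mu2 (lam1 ∘ mu2)); auto; [apply hopf1| |mon| |mon|mon|].
  - apply tens_coalgebra, hopf1.
  - unfold tens_delta.
    (* Precomposing with the coalgebra morphism [mu2] carries the inverse pair [lam1], [id] to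
       [lam1 ∘ mu2], [mu2]. *)
    to (mu1 ∘ (lam1 ⊗ H) ∘ ((mu2 ⊗ mu2) ∘ ((H ⊗ braid H H ⊗ H) ∘ (delta ⊗ delta)))).
    rewrite <- dm2.
    to ((mu1 ∘ (lam1 ⊗ H) ∘ delta) ∘ mu2).
    rewrite al1. rewrite <- em2. mon.
  - unfold tens_delta.
    to ((mu1 ∘ (mu2 ⊗ G) ∘ (H ⊗ braid H H ⊗ H) ∘ (delta ⊗ H ⊗ H))
        ∘ (H ⊗ H ⊗ G) ∘ (H ⊗ delta ⊗ H)).
    rewrite <- compat.
    to (mu2 ∘ (H ⊗ (mu1 ∘ (H ⊗ G) ∘ (delta ⊗ H)))).
    rewrite mul2_Gamma, <- ass2.
    rewrite <- mul2_Gamma at 1.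
    to (mu1 ∘ (H ⊗ G) ∘ ((delta ∘ mu2) ⊗ H)).
    rewrite dm2. mon.
Qed.

(** Convolved with [delta], the left side becomes [delta ∘ mu2] and the right side, up to braidings,
    [h1·G(h3, k1) ⊗ h2·G(h4, k2)]. Cocommutativity exchanges [h2] and [h3], giving [mu2 ⊗ mu2] after
    the tensor coproduct. *)
Lemma Gamma_coalgebra_morphism : braided_cocommutative_action H delta G ->
  is_coalgebra_morphism (H ⊠ H) (eps ⊗ eps) (tens_delta H delta H delta) H eps delta G.
Proof using All.
  unfold braided_cocommutative_action; intros cocomm; unpack.
  split; [assumption| |].
  - rewrite G_def; unfold Gamma_of.
    to ((eps ∘ mu1) ∘ (lam1 ⊗ mu2) ∘ (delta ⊗ H)). rewrite em1.
    to (((eps ∘ lam1) ⊗ (eps ∘ mu2)) ∘ (delta ⊗ H)).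
    rewrite em2, (counit_antipode _ _ _ _ _ _ hopf1).
    to ((eps ∘ ((eps ⊗ H) ∘ delta)) ⊗ eps). rewrite cul. mon.
  - unfold tens_delta.
    apply (conv_cancel_l (H ⊠ H) H H (eta1 ⊗ eta1)
      ((mu1 ⊗ mu1) ∘ (H ⊗ braid H H ⊗ H)) eps delta delta (delta ∘ lam1));
      auto; [apply tens_algebra, hopf1|apply hopf1|mon| |mon|mon|].
    { rewrite <- (bialgebra_comul_conv_inv H eta1 mu1 eps delta lam1 H);
        [mon|apply hopf1|assumption|mon|assumption]. }
    to (((mu1 ⊗ mu1) ∘ ((H ⊗ braid H H ⊗ H) ∘ (delta ⊗ delta))) ∘ (H ⊗ G) ∘ (delta ⊗ H)).
    rewrite <- dm1.
    to (delta ∘ (mu1 ∘ (H ⊗ G) ∘ (delta ⊗ H))). rewrite mul2_Gamma, dm2.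
    symmetry.
    to ((mu1 ⊗ mu1) ∘ (H ⊗ (braid H H ∘ (H ⊗ G)) ⊗ G) ∘ (H ⊗ H ⊗ H ⊗ braid H H ⊗ H)
        ∘ (H ⊗ H ⊗ delta ⊗ H ⊗ H) ∘ (((delta ⊗ H) ∘ delta) ⊗ delta)).
    rewrite (braid_mul_r _ _ _ _ _ hG), coass.
    to ((mu1 ⊗ mu1) ∘ (H ⊗ ((G ⊗ H) ∘ (H ⊗ braid H H) ∘ (braid H H ⊗ H)) ⊗ G)
        ∘ (H ⊗ H ⊗ H ⊗ braid H H ⊗ H)
        ∘ (H ⊗ ((H ⊗ delta) ∘ delta) ⊗ H ⊗ H) ∘ (delta ⊗ delta)).
    rewrite <- coass.
    (* The two middle copies of [h] now come from one [braid H H ∘ delta] feeding [G], the pattern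
       that [cocomm] straightens. *)
    to ((mu1 ⊗ mu1)
        ∘ (H ⊗ ((G ⊗ H) ∘ (H ⊗ braid H H) ∘ ((braid H H ∘ delta) ⊗ H)) ⊗ G)
        ∘ (H ⊗ H ⊗ braid H H ⊗ H)
        ∘ (H ⊗ delta ⊗ H ⊗ H) ∘ (delta ⊗ delta)).
    rewrite <- cocomm.
    to ((mu1 ⊗ mu1) ∘ (H ⊗ ((G ⊗ H) ∘ (H ⊗ braid H H)) ⊗ G)
        ∘ (H ⊗ H ⊗ H ⊗ braid H H ⊗ H)
        ∘ (H ⊗ ((delta ⊗ H) ∘ delta) ⊗ H ⊗ H) ∘ (delta ⊗ delta)).
    rewrite coass.
    to ((mu1 ⊗ mu1) ∘ (H ⊗ G ⊗ H ⊗ G)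
        ∘ (H ⊗ H ⊗ ((braid H H ⊗ H) ∘ (H ⊗ braid H H) ∘ (delta ⊗ H)) ⊗ H)
        ∘ (((H ⊗ delta) ∘ delta) ⊗ delta)).
    rewrite <- (braid_comul_l _ _ _ _ _ hd), <- coass, <- mul2_Gamma. mon.
Qed.

End Brace.

Theorem theorem2p17 (C : strict_braided_monoidal_category) (B : hopf_brace C)
    (sB : is_s_hopf_brace B) :
  is_brace_triple (hb_H1 B) (hb_Gamma1 B) (hb_lam2 B).
Proof.
  destruct B as [H eps delta eta1 mu1 lam1 eta2 mu2 lam2 h1 h2 compat].
  destruct sB as [cocomm iso1 iso2 lam2_mu lam_inv].
  unfold is_brace_triple, hb_Gamma1 in *; simpl in *.
  remember (Gamma_of H delta mu1 lam1 mu2) as G eqn:G_def.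
  (* [auto] closes the five fields that are conditions of the s-Hopf brace itself: the two
     isomorphisms, cocommutativity, [lam2_mu] and [lam_inv]. *)
  split; auto.
  - now apply (Gamma_hom _ _ _ _ _ _ _ _ _ _ h1 h2 G_def).
  - apply h2.
  - now apply (Gamma_coalgebra_morphism _ _ _ _ _ _ _ _ _ _ h1 h2 G_def compat).
  - now apply (Gamma_mul _ _ _ _ _ _ _ _ _ _ h1 h2 G_def compat).
  - now apply (Gamma_action _ _ _ _ _ _ _ _ _ _ h1 h2 G_def compat).
  - now apply (Gamma_unit _ _ _ _ _ _ _ _ _ _ h1 h2 G_def compat).
  - eapply comul_antipode; eauto.
  - eapply counit_antipode; eauto.
  - now apply (Gamma_antipode _ _ _ _ _ _ _ _ _ _ h1 h2 G_def compat).
Qed.
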